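(* Let $G=(V\cup\{s\},E)$ be a finite, connected, undirected, loop-free graph (multiple edges allowed) with distinguished sink vertex $s\notin V$, and let $p\in(0,1]$. On a probability space, let $\{B_i(x,e)\}$, indexed by $i\ge 1$, $x\in V$ and edges $e\in E$ with $x\in e$, be independent Bernoulli random variables with parameter $p$. For a configuration $\eta\in\mathbb{Z}_{\ge 0}^V$, the $i$-th toppling of $x\in V$ is $$\overline{T}^{(i)}_x(\eta)=\eta-\Big(\sum_{e\ni x}B_i(x,e)\Big)\mathbbm{1}_x+\sum_{e=\{x,y\}\in E,\ y\neq s}B_i(x,e)\mathbbm{1}_y,$$ where $\mathbbm{1}_v\in\mathbb{Z}^V$ is the indicator vector of $v$. A toppling at $x$ is legal if $\eta_x>d^G(x)$, and in any sequence of topplings the $j$-th toppling performed at $x$ uses $\overline{T}^{(j)}_x$. Then the random stabilisation ${\sf RS}$ is almost surely well-defined: for every configuration $\eta$, almost surely every sequence of legal topplings starting from $\eta$ terminates after finitely many steps (so that a stable configuration is reached), and the resulting stable configuration ${\sf RS}(\eta)$ does not depend on the order in which the legal topplings are performed.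
   Context: $d^G(v)$ denotes the degree of $v$ in $G$, counting edge multiplicities. A configuration $\eta=(\eta_v)_{v\in V}\in\mathbb{Z}_{\ge0}^V$ assigns a number of grains to each non-sink vertex; it is stable if $\eta_v\le d^G(v)$ for all $v\in V$. Grains sent to the sink disappear. *)

(* Defs.v *)
From mathcomp Require Import all_boot all_order all_algebra.
From mathcomp Require Import finmap.
From mathcomp Require Import all_classical all_reals all_analysis.

Set Implicit Arguments.
Unset Strict Implicit.
Unset Printing Implicit Defensive.

Import Order.TTheory GRing.Theory Num.Theory.
Local Open Scope ring_scope.

(* Finite undirected graphs on the vertex set W, with multiple edges (several
   edges may have the same ends) and no loops (an edge has two distinct ends). *)
Record multigraph (W : finType) := Multigraph {
  edge : finType;
  ends : edge -> {set W};
  card_ends : forall e, #|ends e| = 2%N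
}.

Definition deg (W : finType) (G : multigraph W) (w : W) : nat :=
  #|[set e : edge G | w \in ends e]|.

Definition adjacent (W : finType) (G : multigraph W) : rel W :=
  fun u v => [exists e : edge G, ends e == [set u; v]].

Definition connected_graph (W : finType) (G : multigraph W) : Prop :=
  forall u v : W, connect (adjacent G) u v.

(* In what follows the vertex set V u {s} is [option V]: the non-sink vertex v
   is [Some v] and the sink s is [None]. *)

Definition config (V : finType) := {ffun V -> nat}.
Definition zconfig (V : finType) := {ffun V -> int}.

Definition zconfig_of (V : finType) (eta : config V) : zconfig V :=
  [ffun v => (eta v)%:Z].

Definition indic (V : finType) (x : V) : zconfig V :=
  [ffun v => (v == x)%:Z].

Section Toppling.
Variables (V : finType) (G : multigraph (option V)).

(* A realisation of the toppling instructions: [b i x e] is the value of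
   B_i(x,e). Only the values with 1 <= i and x an end of e are ever used. *)
Variable b : nat -> V -> edge G -> bool.

Definition topple (i : nat) (x : V) (eta : zconfig V) : zconfig V :=
  eta - indic x *+ (\sum_(e : edge G | Some x \in ends e) b i x e)%N
      + \sum_(y : V) \sum_(e : edge G | ends e == [set Some x; Some y])
          indic y *+ b i x e.

Definition stable (eta : zconfig V) : Prop :=
  forall v : V, eta v <= (deg G (Some v))%:Z.

Definition legal (x : V) (eta : zconfig V) : bool :=
  (deg G (Some x))%:Z < eta x.

(* In the next two definitions, [u x] is the number of topplings already
   performed at x. *)

Fixpoint run_from (u : V -> nat) (eta : zconfig V) (xs : seq V) : zconfig V :=
  if xs is x :: xs' then
    run_from [eta u with x |-> (u x).+1] (topple (u x).+1 x eta) xs'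
  else eta.

Fixpoint legal_from (u : V -> nat) (eta : zconfig V) (xs : seq V) : bool :=
  if xs is x :: xs' then
    legal x eta &&
    legal_from [eta u with x |-> (u x).+1] (topple (u x).+1 x eta) xs'
  else true.

Definition run (eta : config V) (xs : seq V) : zconfig V :=
  run_from (fun=> 0%N) (zconfig_of eta) xs.

Definition legal_seq (eta : config V) (xs : seq V) : bool :=
  legal_from (fun=> 0%N) (zconfig_of eta) xs.

Definition terminates (eta : config V) : Prop :=
  ~ exists x : nat -> V, forall n : nat, legal_seq eta (mkseq x n).

Definition is_stabilisation (eta zeta : config V) : Prop :=
  [/\ stable (zconfig_of zeta),
      exists2 xs : seq V, legal_seq eta xs & run eta xs = zconfig_of zeta
    & forall xs : seq V, legal_seq eta xs -> stable (run eta xs) ->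
        run eta xs = zconfig_of zeta].

End Toppling.


Definition mutually_independent d (Omega : measurableType d) (R : realType)
    (P : probability Omega R) d' (S : measurableType d') (I : choiceType)
    (J : set I) (X : I -> Omega -> S) : Prop :=
  forall (K : {fset I}) (A : I -> set S),
    ([set` K] `<=` J)%classic -> (forall k, measurable (A k)) ->
    P (\bigcap_(k in [set` K]) (X k @^-1` A k))%classic =
    (\prod_(k <- K) P (X k @^-1` A k)%classic)%E.

(* Main.v *)
Require Import Defs.
From mathcomp Require Import all_boot all_order all_algebra.
From mathcomp Require Import finmap zify ring.
From mathcomp Require Import all_classical all_reals all_analysis.
Import Order.TTheory GRing.Theory Num.Theory.
Local Open Scope ring_scope.

(* The configuration reached by a sequence of topplings depends only on how
   often each vertex has been toppled (the odometer). A legal sequence topples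
   each vertex at most as often as any stabilising sequence, so two legal
   stabilising sequences have the same odometer and the same outcome.
   For termination, independence makes every instruction B_i(x,e) equal to 1
   for infinitely many i, almost surely. Grains are conserved if those in the
   sink are counted, so if x is toppled infinitely often, a neighbour of x,
   receiving unboundedly many grains, must be toppled infinitely often as well.
   By connectedness this would reach the sink, which never topples. *)

Set Implicit Arguments.
Unset Strict Implicit.
Unset Printing Implicit Defensive.

(** * Independent trials: almost surely infinitely many escape a fixed set *)

Section InfinitelyOften.
Local Open Scope classical_set_scope.
Context (R : realType) d (Omega : measurableType d) (P : probability Omega R).
Context d' (S : measurableType d') (I : choiceType).
Variables (J : set I) (X : I -> Omega -> S).
Hypothesis mX : forall i, measurable_fun setT (X i).
Hypothesis indX : mutually_independent P J X.

Lemma prob_avoid_expn (h : nat -> I) (A : set S) (q : R) (m k : nat) :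
    injective h -> (forall n, J (h n)) -> measurable A ->
    (forall n, P (X (h n) @^-1` A) = q%:E) ->
  P (\bigcap_(n in [set n | (m <= n < m + k)%N]) X (h n) @^-1` A)
  = (q ^+ k)%:E.
Proof.
move=> h_inj hJ mA PA.
pose s := [seq h n | n <- iota m k].
pose K := [fset x in s]%fset.
have sK x : x \in K -> exists2 n, (m <= n < m + k)%N & x = h n.
  by rewrite inE /= => /mapP[n]; rewrite mem_iota => ? ->; exists n.
have KJ : [set` K] `<=` J by move=> x /sK [n _ ->].
have -> : \bigcap_(n in [set n | (m <= n < m + k)%N]) X (h n) @^-1` A =
          \bigcap_(x in [set` K]) X x @^-1` A.
  apply/seteqP; split => w /= wA x /=.
    by move=> /sK [n nmk ->]; exact: wA.
  by move=> xmk; apply: wA; rewrite /= inE /= map_f ?mem_iota.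
rewrite (indX KJ (A := fun=> A))// big_seq.
rewrite (eq_bigr (fun=> q%:E)) => [|x /sK[n _ ->]]; last exact: PA.
rewrite -big_seq.
have -> : k = size K.
  by rewrite card_fseq undup_id ?size_map ?size_iota// map_inj_uniq ?iota_uniq.
by elim: (enum_fset K) => [|x t IH]; rewrite ?big_nil ?big_cons ?IH //= exprS EFinM.
Qed.

(** For fixed [m], staying in [A] at all indices from [m] on has probability at most [q ^+ k] for
    every [k], hence zero; there are countably many [m]. *)
Lemma ae_infinitely_often (h : nat -> I) (A : set S) (q : R) :
    injective h -> (forall n, J (h n)) -> measurable A -> 0 <= q < 1 ->
    (forall n, P (X (h n) @^-1` A) = q%:E) ->
  {ae P, forall w, forall m, exists2 n, (m <= n)%N & ~ A (X (h n) w)}.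
Proof.
move=> h_inj hJ mA /andP[q_ge0 q_lt1] PA; apply: ae_foralln => m.
have mXA n : measurable (X (h n) @^-1` A).
  by rewrite -[X in measurable X]setTI; exact: mX.
pose D := \bigcap_(n in [set n | (m <= n)%N]) X (h n) @^-1` A.
have mD : measurable D by exact: bigcap_measurableType.
exists D; split => //.
- apply/eqP; rewrite eq_le measure_ge0 andbT.
  have PD k : (P D <= (q ^+ k)%:E)%E.
    rewrite -(prob_avoid_expn m k h_inj hJ mA PA).
    apply: le_measure; rewrite ?inE//; first exact: bigcap_measurableType.
    by move=> w Dw n /= /andP[mn _]; exact: Dw.
  have Dfin : P D \is a fin_num by rewrite fin_num_measure.
  suff : fine (P D) <= 0 by rewrite -lee_fin fineK.
  have q0 : (GRing.exp q : R ^nat) @ \oo --> 0 by apply: cvg_expr; rewrite ger0_norm.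
  apply: (cvgr_to_ge q0); apply: nearW => k.
  by rewrite -lee_fin fineK.
- move=> w /= nw n /= mn; apply: contrapT => nA; apply: nw.
  by exists n.
Qed.

End InfinitelyOften.

(** * Odometers: abelian property, least action and conservation of grains *)

Section Odometer.
Variables (V : finType) (G : multigraph (option V)).
Variables (b : nat -> V -> edge G -> bool) (eta : config V).
Implicit Types (u t : V -> nat) (x v : V) (w : option V) (e : edge G).
Implicit Types (xs ys : seq V).

Local Notation incr u x := [eta u with x |-> (u x).+1].

(** The shift [i.+1] reflects that instructions are numbered from 1. *)
Definition crossings u x e : nat := \sum_(i < u x) b i.+1 x e.

(* At [w = None] this counts the grains lost to the sink. *)
Definition received u w : nat :=
  (\sum_x \sum_(e | ends e == [set Some x; w]) crossings u x e)%N.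

Definition emitted u v : nat :=
  (\sum_(e | Some v \in ends e) crossings u v e)%N.

(** Integer-valued, since an arbitrary [u] need not come from a legal sequence and may leave
    negative entries. *)
Definition balance u : zconfig V :=
  [ffun v => (eta v)%:Z + (received u (Some v))%:Z - (emitted u v)%:Z].

Definition odometer xs : V -> nat := fun x => count_mem x xs.

Lemma crossings_incr u x y e :
  crossings (incr u x) y e = (crossings u y e + (y == x) * b (u x).+1 x e)%N.
Proof.
rewrite /crossings /=; case: eqVneq => [->|_]; last by rewrite addn0.
by rewrite big_ord_recr mul1n.
Qed.

Lemma received_incr u x w :
  received (incr u x) w =
  (received u w + \sum_(e | ends e == [set Some x; w]) b (u x).+1 x e)%N.
Proof.
rewrite /received (bigD1 x)//= [in RHS](bigD1 x)//= addnAC; congr (_ + _)%N.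
  by rewrite -big_split; apply: eq_bigr => e _; rewrite crossings_incr eqxx mul1n.
apply: eq_bigr => y yx; apply: eq_bigr => e _.
by rewrite crossings_incr (negbTE yx) addn0.
Qed.

Lemma emitted_incr u x v :
  emitted (incr u x) v =
  (emitted u v + (v == x) * \sum_(e | Some x \in ends e) b (u x).+1 x e)%N.
Proof.
rewrite /emitted; case: (eqVneq v x) => [->|vx]; last first.
  by rewrite addn0; apply: eq_bigr => e _; rewrite crossings_incr (negbTE vx) addn0.
by rewrite mul1n -big_split; apply: eq_bigr => e _; rewrite crossings_incr eqxx mul1n.
Qed.

(** The abelian property: a toppling at [x] uses the next instructions at [x], whatever was toppled
    elsewhere, so only the counts matter. *)
Lemma topple_balance u x :
  topple b (u x).+1 x (balance u) = balance (incr u x).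
Proof.
apply/ffunP => v; rewrite !ffunE received_incr emitted_incr !PoszD.
rewrite sum_ffunE (bigD1 v)//= [X in _ + (_ + X) = _]big1 ?addr0 => [|y yv]; last first.
  rewrite sum_ffunE big1// => e _; rewrite ffunMnE ffunE eq_sym (negbTE yv).
  by rewrite mul0rn.
rewrite sum_ffunE (ffunMnE (Defs.indic x)) ffunE.
under [X in _ + X = _]eq_bigr do rewrite (ffunMnE (Defs.indic v)) ffunE eqxx natz.
have -> : \sum_(e | ends e == [set Some x; Some v]) (b (u x).+1 x e)%:Z =
    (\sum_(e | ends e == [set Some x; Some v]) b (u x).+1 x e)%N%:Z :> int.
  by rewrite -!natz natr_sum; apply: eq_bigr => e _; rewrite natz.
by rewrite -[X in _ - X + _]mulr_natr natz PoszM !addrA opprD addrA; ring.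
Qed.

Lemma run_from_balance u xs :
  run_from b u (balance u) xs = balance (fun x => u x + odometer xs x)%N.
Proof.
elim: xs u => [|x xs IH] u /=.
  by congr balance; apply/funext => x; rewrite addn0.
rewrite topple_balance IH; congr balance; apply/funext => y /=.
by rewrite /odometer /= (eq_sym x); case: eqVneq => [->|]; lia.
Qed.

Lemma balance0 : balance (fun=> 0%N) = zconfig_of eta.
Proof.
apply/ffunP => v; rewrite !ffunE /received /emitted.
have c0 x e : crossings (fun=> 0%N) x e = 0%N by rewrite /crossings big_ord0.
rewrite !big1 ?addr0 ?subr0// => x _; rewrite ?c0// big1// => e _; exact: c0.
Qed.

Lemma run_balance xs : run b eta xs = balance (odometer xs).
Proof. by rewrite /run -balance0 run_from_balance. Qed.

Lemma legal_from_rcons u xs x :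
  legal_from b u (balance u) (rcons xs x) =
  legal_from b u (balance u) xs &&
  legal G x (balance (fun y => u y + odometer xs y)%N).
Proof.
elim: xs u => [|y xs IH] u /=.
  rewrite andbT; congr (legal _ _ (balance _)); apply/funext => y /=.
  by rewrite addn0.
rewrite topple_balance IH andbA; congr (_ && legal _ _ (balance _)).
apply/funext => z /=.
by rewrite /odometer /= (eq_sym y); case: eqVneq => [->|]; lia.
Qed.

Lemma legal_seq_rcons xs x :
  legal_seq b eta (rcons xs x) =
  legal_seq b eta xs && legal G x (balance (odometer xs)).
Proof. by rewrite /legal_seq -balance0 legal_from_rcons. Qed.

Lemma odometer_rcons xs x : odometer (rcons xs x) = incr (odometer xs) x.
Proof.
apply/funext => y; rewrite /odometer /= -cats1 count_cat /= (eq_sym x).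
by case: eqVneq => [->|]; lia.
Qed.

Lemma crossings_mono u t x e : (u x <= t x)%N ->
  (crossings u x e <= crossings t x e)%N.
Proof.
by move=> ut; rewrite /crossings -(subnKC ut) big_split_ord leq_addr.
Qed.

Lemma received_mono u t w : (forall x, u x <= t x)%N ->
  (received u w <= received t w)%N.
Proof.
move=> ut; apply: leq_sum => x _; apply: leq_sum => e _.
exact: crossings_mono.
Qed.

Lemma balance_mono u t v : (forall x, u x <= t x)%N -> u v = t v ->
  balance u v <= balance t v.
Proof.
move=> ut uv; rewrite !ffunE; have := received_mono (Some v) ut.
have -> : emitted u v = emitted t v.
  by rewrite /emitted /crossings uv.
by lia.
Qed.

(* Least action: if the legal sequence were to exceed [t], then just before the
   first excess, at [x], the balance at [x] would be at most that of [t]. *)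
Lemma least_action xs t : legal_seq b eta xs -> stable G (balance t) ->
  forall x, (odometer xs x <= t x)%N.
Proof.
move=> + st; elim/last_ind: xs => [//|xs x IH].
rewrite legal_seq_rcons => /andP[/IH le_t lx] y.
rewrite odometer_rcons /=; case: eqVneq => [->|//].
rewrite ltn_neqAle le_t andbT; apply/eqP => eq_t.
have := le_lt_trans (le_trans (balance_mono le_t eq_t) (st x)) lx.
by rewrite ltxx.
Qed.

(** A toppling removes at most the degree of [x], and legality provides more grains than that; all
    other vertices can only gain. *)
Lemma legal_balance_ge0 xs : legal_seq b eta xs ->
  forall v, 0 <= balance (odometer xs) v.
Proof.
elim/last_ind: xs => [|xs x IH].
  by move=> _ v; rewrite -run_balance /run /= ffunE.
rewrite legal_seq_rcons odometer_rcons => /andP[/IH ge0 lx] v.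
set u := odometer xs in ge0 lx *.
have := ge0 v; move: lx; rewrite /legal !ffunE received_incr emitted_incr.
case: (eqVneq v x) => [->|_]; last by lia.
rewrite mul1n => lx _.
have : (\sum_(e | Some x \in ends e) b (u x).+1 x e <= deg G (Some x))%N.
  rewrite /deg -sum1dep_card; apply: leq_sum => e _; exact: leq_b1.
by lia.
Qed.

(** Without loops, the opposite end is unique. The sum form serves the double counting in
    [sum_received]. *)
Lemma ends_other w0 e : w0 \in ends e ->
  (\sum_(w : option V | ends e == [set w0; w]) 1 = 1)%N.
Proof.
have /eqP/cards2P[w1 [w2 [w12 ->]]] := card_ends e.
wlog : w1 w2 w12 / w0 = w1 => [WH|->{w0} _].
  by rewrite !inE => /orP[]/eqP w0E; [|rewrite finset.setUC]; apply: WH;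
     rewrite // 1?eq_sym // !inE w0E eqxx.
rewrite (big_pred1 w2)// => w; apply/eqP/eqP => [/setP|->//].
move=> /[dup]/(_ w2); rewrite !inE eqxx orbT => /esym/orP[/eqP w21|/eqP//].
by rewrite w21 eqxx in w12.
Qed.

Lemma sum_received u : (\sum_w received u w = \sum_v emitted u v)%N.
Proof.
rewrite /received exchange_big; apply: eq_bigr => x _.
rewrite /emitted (exchange_big_dep (fun e => Some x \in ends e))/=.
  apply: eq_bigr => e xe.
  rewrite -[RHS]muln1 -(ends_other xe) big_distrr/=.
  by apply: eq_bigr => w _; rewrite muln1.
by move=> w e _ /eqP ->; rewrite !inE eqxx.
Qed.

(** Every vertex other than [w] emits at most its initial grains plus what it receives; subtracting
    this from global conservation isolates [w]. The default 0 says that the sink emits nothing. *)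
Lemma received_le xs w : legal_seq b eta xs ->
  (received (odometer xs) w <=
   \sum_v eta v + oapp (emitted (odometer xs)) 0 w)%N.
Proof.
move=> /legal_balance_ge0; set u := odometer xs => ge0.
have le v : (emitted u v <= eta v + received u (Some v))%N.
  by have := ge0 v; rewrite ffunE; lia.
have sum_opt (F : V -> nat) : (\sum_w oapp F 0 w = \sum_v F v)%N.
  by rewrite (bigD1 None)//= add0n (reindex_omap Some id)//=;
     [apply: eq_bigl => v; rewrite eqxx | case].
have := sum_received u; rewrite -(sum_opt eta) -(sum_opt (emitted u)).
rewrite (bigD1 w)//= [in RHS](bigD1 w)//=.
have : (\sum_(w' | w' != w) oapp (emitted u) 0 w' <=
        \sum_(w' | w' != w) (oapp eta 0 w' + received u w'))%N.
  by apply: leq_sum => -[v|] _ //=.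
rewrite big_split /= [in X in _ -> _ -> X](bigD1 w) //=; lia.
Qed.

Lemma emitted_le u v : (emitted u v <= u v * #|edge G|)%N.
Proof.
rewrite /emitted mulnC -sum_nat_const big_mkcond; apply: leq_sum => e _.
case: ifP => // _; rewrite /crossings -[X in (_ <= X)%N]card_ord -sum1_card.
by apply: leq_sum => i _; exact: leq_b1.
Qed.

End Odometer.

Arguments crossings_mono {V G} b {u t x} e.

(** * Termination when every instruction equals 1 infinitely often *)

Section Stabilisation.
Variables (V : finType) (G : multigraph (option V)).
Variables (b : nat -> V -> edge G -> bool) (eta : config V).
Implicit Types (x v : V) (w : option V) (e : edge G) (xs ys : seq V).

Hypothesis b_io : forall x e, Some x \in ends e ->
  forall m, exists2 n, (m <= n)%N & b n.+1 x e.

Lemma crossings_unbounded x e : Some x \in ends e ->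
  forall K, exists k, (K <= \sum_(i < k) b i.+1 x e)%N.
Proof.
move=> xe; elim=> [|K [k Kk]]; first by exists 0%N.
have [n kn bn] := b_io xe k; exists n.+1.
rewrite big_ord_recr /= bn addn1 ltnS (leq_trans Kk)//.
exact: (@crossings_mono _ _ b (fun=> k) (fun=> n) x e kn).
Qed.

Section InfiniteSequence.
Variable x : nat -> V.
Hypothesis x_legal : forall n, legal_seq b eta (mkseq x n).

Let topplings n : V -> nat := odometer (mkseq x n).
Let recurrent v := forall k, exists n, (k <= topplings n v)%N.

Lemma exists_recurrent : exists v, recurrent v.
Proof.
apply: contrapT => /forallNP nrec.
have /choice[K HK] v : exists k, forall n, (topplings n v <= k)%N.
  have /existsNP[k /forallNP Hk] := nrec v; exists k => n.
  by apply: ltnW; rewrite ltnNge; apply/negP/Hk.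
(* Pigeonhole: one toppling more than all the bounds together allow. *)
pose n := (\sum_v K v).+1.
have : (\sum_v topplings n v <= \sum_v K v)%N by apply: leq_sum => v _.
have -> : (\sum_v topplings n v = n)%N; last by rewrite ltnn.
rewrite /topplings /odometer -[RHS](size_mkseq x n).
elim: (mkseq x n) => [|y ys IH] /=; first by rewrite big1.
rewrite big_split /= IH (bigD1 y)//= eqxx big1 ?addn0// => z zy.
by rewrite eq_sym (negbTE zy).
Qed.

(** If [w] were the sink or not recurrent, its emission would stay bounded, hence also its intake by
    [received_le]; but the edge from [v] alone delivers unboundedly many grains. *)
Lemma recurrent_adjacent v w : recurrent v -> Defs.adjacent G (Some v) w ->
  exists2 v', w = Some v' & recurrent v'.
Proof.
move=> rv /existsP[e /eqP ee]; apply: contrapT => nw.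
have [k kP] : exists k, forall n, (oapp (emitted b (topplings n)) 0 w <= k)%N.
  case: w nw {ee} => [v'|_]; last by exists 0%N.
  move=> nw; have /existsNP[k /forallNP Hk] : ~ recurrent v'.
    by move=> rv'; apply: nw; exists v'.
  exists (k * #|edge G|)%N => n; apply: (leq_trans (emitted_le _ _ _)).
  by rewrite leq_mul2r ltnW ?orbT// ltnNge; apply/negP/Hk.
have ve : Some v \in ends e by rewrite ee !inE eqxx.
have [j jP] := crossings_unbounded ve (\sum_v eta v + k).+1.
have [n jn] := rv j.
have := received_le w (x_legal n); apply/negP; rewrite -ltnNge.
apply: (@leq_trans (\sum_v eta v + k).+1); first by rewrite ltnS leq_add2l; exact: kP.
apply: (leq_trans jP).
apply: (leq_trans (@crossings_mono _ _ b (fun=> j) (topplings n) v e jn)).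
by rewrite /received (bigD1 v)//= (bigD1 e) ?ee//= -addnA leq_addr.
Qed.

End InfiniteSequence.

Lemma legal_terminates : connected_graph G -> terminates b eta.
Proof.
move=> conn [x x_legal]; have [v rv] := exists_recurrent x.
have /connectP[p] := conn (Some v) None.
(* Recurrence propagates along the path; the empty path would identify [Some v] with the sink. *)
elim: p v rv => [//|w p IH] v rv /= /andP[vw].
by have [v' ->] := recurrent_adjacent x_legal rv vw; exact: IH.
Qed.

End Stabilisation.

(** * Existence and uniqueness of the stabilisation *)

Lemma terminates_stable (V : finType) (G : multigraph (option V)) b
    (eta : config V) : @terminates V G b eta ->
  exists2 xs, legal_seq b eta xs & stable G (run b eta xs).
Proof.
move=> term; apply: contrapT => nstab; apply: term.
have ext xs : legal_seq b eta xs -> exists x, legal_seq b eta (rcons xs x).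
  move=> lxs; have /existsNP[x xP] : ~ stable G (run b eta xs).
    by move=> sxs; apply: nstab; exists xs.
  exists x; rewrite legal_seq_rcons lxs /legal -run_balance /=.
  by rewrite ltNge; apply/negP.
(* A default vertex for illegal sequences; [V] is not assumed inhabited. *)
have [x0 _] := ext [::] isT.
have /choice[f fP] xs : exists x,
    legal_seq b eta xs -> legal_seq b eta (rcons xs x).
  by case: (boolP (legal_seq b eta xs)) => [/ext[x ?]|_]; [exists x|exists x0].
(* Iterating the extension yields an infinite legal sequence whose prefixes are the [g n]. *)
pose g n := iter n (fun s => rcons s (f s)) [::].
exists (f \o g) => n; have -> : mkseq (f \o g) n = g n.
  by elim: n => [//|n IH]; rewrite mkseqS IH.
by elim: n => [//|n IH]; exact: fP.
Qed.

Lemma terminates_is_stabilisation (V : finType) (G : multigraph (option V)) b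
    (eta : config V) : @terminates V G b eta ->
  exists zeta, is_stabilisation b eta zeta.
Proof.
move=> /terminates_stable[xs lxs sxs].
(* The absolute value changes nothing, as legal runs stay nonnegative. *)
pose zeta : config V := [ffun v => `|run b eta xs v|%N].
have zE : zconfig_of zeta = run b eta xs.
  by apply/ffunP => v; rewrite !ffunE gez0_abs// run_balance legal_balance_ge0.
exists zeta; split; rewrite zE//; first by exists xs.
move=> ys lys; rewrite !run_balance in sxs * => sys.
(* Least action in both directions equates the odometers. *)
congr balance; apply/funext => x; apply/eqP; rewrite eqn_leq.
by rewrite (least_action lxs sys) (least_action lys sxs).
Qed.

Theorem theorem2p2 (V : finType) (G : multigraph (option V))
    (Gconn : connected_graph G)
    (R : realType) (p : R) (p_gt0 : 0 < p) (p_le1 : p <= 1)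
    (d : measure_display) (Omega : measurableType d)
    (P : probability Omega R)
    (B : nat -> V -> edge G -> {RV P >-> bool})
    (B_bernoulli : forall (i : nat) (x : V) (e : edge G),
      (1 <= i)%N -> Some x \in ends e ->
      distribution P (B i x e) =1 bernoulli_prob p)
    (B_indep : mutually_independent P
      [set k : nat * V * edge G | (1 <= k.1.1)%N /\ Some k.1.2 \in ends k.2]%classic
      (fun k => B k.1.1 k.1.2 k.2 : Omega -> bool)) :
  forall eta : config V,
    {ae P, forall omega : Omega,
      let b := fun i x e => B i x e omega in
      terminates b eta /\ exists zeta : config V, is_stabilisation b eta zeta}.
Proof.
move=> eta.
have io : {ae P, forall omega (k : V * edge G), Some k.1 \in ends k.2 ->
    forall m, exists2 n, (m <= n)%N & B n.+1 k.1 k.2 omega}.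
  (* Only finitely many pairs [(x, e)], so each may be treated separately. *)
  apply: filter_forall => -[x e] /=.
  have [xe|nxe] := boolP (Some x \in ends e); last exact: aeW.
  have B0 n : P (B n.+1 x e @^-1` [set false])%classic = (1 - p)%:E.
    have -> : P (B n.+1 x e @^-1` [set false])%classic =
              distribution P (B n.+1 x e) [set false]%classic by [].
    rewrite B_bernoulli// bernoulli_probE ?p_le1 ?ltW//.
    by rewrite !diracE !classical_sets.in_set1 /= mule0 add0e mule1.
  (* The strict bound is where [0 < p] enters. *)
  have q01 : 0 <= 1 - p < 1 by rewrite subr_ge0 p_le1 ltrBlDr ltrDl.
  pose h n : nat * V * edge G := (n.+1, x, e).
  have h_inj : injective h by move=> i j [].
  have mB (k : nat * V * edge G) :
      measurable_fun setT (B k.1.1 k.1.2 k.2 : Omega -> bool) by [].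
  have := ae_infinitely_often mB B_indep h_inj (fun n => conj (ltn0Sn n) xe)
    (I : measurable [set false]%classic) q01 B0.
  apply: filterS => omega hio _ m; have [n mn nB] := hio m.
  by exists n => //; apply: contra_notT nB => /negbTE.
apply: filterS io => omega io.
have term : terminates (fun i x e => B i x e omega) eta.
  by apply: legal_terminates Gconn => x e; exact: (io (x, e)).
by split=> //; exact: terminates_is_stabilisation.
Qed.
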